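(* Let $\beta>1$ be an integer. For fixed $\lambda>0$ and the sequence $n_k=\lfloor \beta^k\lambda\rfloor$ it follows that \[ \lim_{k\to\infty}\mathbb{P}\big(M_{n_k}\leq 1-\beta^{-k}\big)=e^{-\frac{\beta-1}{\beta}\lambda}. \]
   Context: The Rényi map is $f:[0,1)\to[0,1)$, $f(x)=\beta x \pmod 1$, where $\beta>1$ is an integer. The stochastic process $(X_i)_{i=0}^\infty$ is defined by $X_0\sim U(0,1)$ (uniform distribution) and $X_{i+1}=f(X_i)$ for $i\geq 0$. The partial maximum is $M_n=\max(X_0,\dots,X_{n-1})$ for $n\geq 1$ (note that $n_k\ge 1$ for all sufficiently large $k$). *)

(* Defs.v *)
From HB Require Import structures.
From mathcomp Require Import all_boot all_order all_algebra.
From mathcomp Require Import all_classical all_reals all_analysis.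
Import Order.TTheory GRing.Theory Num.Theory.
Import numFieldNormedType.Exports.

Set Implicit Arguments.
Unset Strict Implicit.
Unset Printing Implicit Defensive.

Local Open Scope ring_scope.

(* The fractional part of beta x, on all of R; the Rényi map is its restriction
   to [0, 1), which it maps to itself (renyi_map_itv). A uniform variable on
   (0, 1) leaves [0, 1) only on a null event, so the extension is harmless. *)
Definition renyi_map {R : realType} (beta : nat) (x : R) : R :=
  beta%:R * x - (Num.floor (beta%:R * x))%:~R.

Lemma renyi_map_itv {R : realType} (beta : nat) (x : R) :
  0 <= renyi_map beta x < 1.
Proof.
rewrite /renyi_map subr_ge0 floor_le ltrBlDr addrC.
by have := floorD1_gt (beta%:R * x); rewrite intrD.
Qed.

(* The law is compared on Borel sets only: the value of a measure on other
   sets is unspecified. The endpoints are null for uniform_prob. *)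
Definition uniform01 {d : measure_display} {T : measurableType d}
    {R : realType} (P : probability T R) (X : {RV P >-> R}) : Prop :=
  forall A : set R, measurable A ->
    distribution P X A = uniform_prob (@ltr01 R) A.

(* Meaningful for 0 < n. *)
Definition partial_max {T : Type} {R : realType} (X : nat -> T -> R)
    (n : nat) (w : T) : R :=
  \big[Num.max/X 0 w]_(1 <= i < n) X i w.

(* Main.v *)
Require Import Defs.
From HB Require Import structures.
From mathcomp Require Import all_boot all_order all_algebra.
From mathcomp Require Import all_classical all_reals all_analysis.
From mathcomp Require Import measurable_realfun.
From mathcomp Require Import ring lra zify.
Import Order.TTheory GRing.Theory Num.Theory.
Import numFieldNormedType.Exports.
Local Open Scope classical_set_scope.
Local Open Scope ring_scope.

(** Write f for the map, e = beta^-k, u = 1 - e, and let q n be the uniform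
    measure of E n = {x | f^i x <= u for all i < n} ([orbit_le]), which is the
    probability that the partial maximum of length n is at most u.

    The point is that q satisfies a linear recursion with delay k. Since f
    preserves the uniform measure, q n is also the measure of f^-1 (E n). Those
    x in f^-1 (E n) with x <= u form E (n+1). Those with x > u have a base-beta
    expansion starting with exactly k digits beta-1: the first k digits are
    maximal because x > u, and the next one is not because f x <= u. After such
    a start the next k iterates are automatically at most u, so the only
    remaining condition is f^(k+1) x in E (n-k), which involves fresh digits.
    Hence, up to two endpoints ([uniform01_orbit_le_rec]),
      q n = q (n+1) + p q (n-k),   p = e (beta-1)/beta,   for n >= 1.
    The factor (beta-1)/beta, the chance that a run of maximal digits stops, is
    what the clustering of large values contributes to the limit.

    As q decreases by at most e at each step, q (n-k) lies between q n and
    q n + k e. So q n is (1-p)^n up to an error of order e + n p k e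
    ([delayed_recursion_bounds]). For n = floor (lambda / e) the product n p
    tends to lambda (beta-1)/beta, whence the exponential, while k e tends
    to 0. *)

(** * The uniform law on the unit interval *)

(** The support `[0, 1] is replaced by a half-open interval, up to a null point,
    because half-open intervals split exactly into the branches of the map. *)
Lemma uniform01E (R : realType) (A : set R) : measurable A ->
  uniform_prob (@ltr01 R) A = lebesgue_measure (A `&` `[0, 1[).
Proof.
move=> mA; rewrite /uniform_prob integral_uniform_pdf.
under eq_integral => x.
  rewrite inE => -[_]; rewrite /= in_itv /= => x01.
  rewrite /uniform_pdf x01 subr0 invr1; over.
rewrite integral_cst ?mul1e //; last exact: measurableI.
have -> : A `&` `[0, 1] = A `&` `[0, 1[ `|` A `&` [set 1].
  rewrite -setIUr; congr (A `&` _); apply/seteqP; split=> x /=.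
    rewrite !in_itv /= => /andP[x0]; rewrite le_eqVlt => /orP[/eqP ->|x1].
      by right.
    by left; rewrite x0.
  rewrite !in_itv /= => -[/andP[-> /ltW ->]//|->]; by rewrite ler01 lexx.
rewrite measureU0 //; try exact: measurableI.
apply/eqP; rewrite -measure_le0 -(lebesgue_measure_set1 (1 : R)).
by apply: le_measure; rewrite ?inE //; exact: measurableI.
Qed.

(** Points are null. The recursion for the orbits needs two exceptions: there
    the two sets compared disagree at the ends of one interval. *)
Lemma eq_uniform01 (R : realType) (a b : R) (A B : set R) :
  measurable A -> measurable B ->
  (forall x, 0 <= x < 1 -> x != a -> x != b -> A x <-> B x) ->
  uniform_prob (@ltr01 R) A = uniform_prob (@ltr01 R) B.
Proof.
move=> mA mB AB; rewrite !uniform01E //.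
pose N : set R := [set a] `|` [set b].
have mN : measurable N by exact: measurableU.
have N0 : lebesgue_measure N = 0%E.
  by rewrite measureU0 //; exact: lebesgue_measure_set1.
have key (C : set R) : measurable C -> lebesgue_measure (C `&` `[0, 1[) =
    lebesgue_measure ((C `&` `[0, 1[) `\` N).
  move=> mC; have mC1 : measurable (C `&` `[0, 1[) by exact: measurableI.
  rewrite (measureDI lebesgue_measure mC1 mN).
  rewrite [X in (_ + X)%E](_ : _ = 0%E) ?adde0 //.
  apply/eqP; rewrite -measure_le0 -N0.
  by apply: le_measure; rewrite ?inE //; exact: measurableI.
rewrite key // [RHS]key //; congr lebesgue_measure.
by apply/seteqP; split=> x [[] Cx] x01 Nx; (do 2?split=> //);
  move: x01; rewrite /= in_itv /= => x01; move: Cx; apply AB => //;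
  apply/eqP => xE; apply: Nx; rewrite /N xE; by [left|right].
Qed.

(** Scaling A by s^-1 and moving it by c divides its measure by s. Both sides
    are measures in A, so it suffices to compare them on half-open intervals. *)
Lemma lebesgue_measure_affine (R : realType) (s c : R) (A : set R) :
  0 < s -> measurable A ->
  lebesgue_measure [set x | A (s * (x - c))] =
  ((s^-1)%:E * lebesgue_measure A)%E.
Proof.
move=> s0 mA.
pose phi : measurableTypeR R -> measurableTypeR R := fun x => s * (x - c).
have mphi : measurable_fun setT phi.
  by apply: measurable_funM => //; exact: measurable_funB.
have s0' : 0 <= s by exact: ltW.
have -> : lebesgue_measure A = (s%:E * pushforward lebesgue_measure phi A)%E.
  apply: (@lebesgue_measure_unique _ (mscale (NngNum s0')
    (pushforward lebesgue_measure phi))) => //.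
  move=> _ [[a b]] _ <-.
  change (lebesgue_measure `]a, b]%classic =
    s%:E * lebesgue_measure (phi @^-1` `]a, b]%classic))%E.
  have -> : phi @^-1` `]a, b] = `]c + a / s, c + b / s]%classic.
    apply/seteqP; split=> x; rewrite /phi /= !in_itv /= -ltrBrDl -lerBlDl.
      by rewrite ltr_pdivrMr // ler_pdivlMr // ![_ * s]mulrC.
    by rewrite ltr_pdivrMr // ler_pdivlMr // ![_ * s]mulrC.
  rewrite !lebesgue_measure_itv /= !lte_fin ltrD2l ltr_pM2r ?invr_gt0 //.
  case: ifP => _; last by rewrite mule0.
  by rewrite -!EFinB -EFinM; congr EFin; field; rewrite gt_eqF.
by rewrite muleA -EFinM mulVf ?gt_eqF // mul1e.
Qed.

(** Seen through the affine bijection of [c, c + 1/s[ onto [0, 1[, the uniform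
    law restricted to the small interval is 1/s times the uniform law. *)
Lemma uniform01_affine (R : realType) (s c : R) (A : set R) :
  0 < s -> 0 <= c -> c + s^-1 <= 1 -> measurable A ->
  uniform_prob (@ltr01 R) (`[c, c + s^-1[ `&` [set x | A (s * (x - c))]) =
  ((s^-1)%:E * uniform_prob (@ltr01 R) A)%E.
Proof.
move=> s0 c0 cs mA.
have mphi : measurable_fun setT (fun x : R => s * (x - c)).
  by apply: measurable_funM => //; exact: measurable_funB.
have mA' : measurable [set x | A (s * (x - c))].
  by rewrite -[X in measurable X]setTI; exact: mphi.
rewrite !uniform01E //; last exact: measurableI.
rewrite -(lebesgue_measure_affine _ s c) //; last exact: measurableI.
congr lebesgue_measure; apply/seteqP.
have E x : (x \in `[c, c + s^-1[) = (s * (x - c) \in `[0, 1[).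
  rewrite !in_itv /= pmulr_rge0 // subr_ge0 -ltrBlDl.
  by rewrite -[s^-1]mul1r ltr_pdivlMr // [_ * s]mulrC.
split=> x /=.
  by move=> [[xc Ax] _]; split => //; rewrite -E.
rewrite -E => -[Ax xc]; split => //; move: xc; rewrite !in_itv /= => /andP[cx xc].
by rewrite (le_trans c0 cx) (lt_le_trans xc cs).
Qed.

(** * The Rényi map preserves the uniform law *)

Lemma renyi_map_branch (R : realType) (beta j : nat) (x : R) :
  j%:R <= beta%:R * x < j.+1%:R -> renyi_map beta x = beta%:R * x - j%:R.
Proof.
by move=> jx; rewrite /renyi_map (@floor_def _ _ (Posz j)) //
  intrD -!pmulrn natr1.
Qed.

Lemma measurable_renyi_map (R : realType) (beta : nat) :
  measurable_fun setT (renyi_map beta : R -> R).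
Proof.
have mfloor : measurable_fun setT (fun y : R => (Num.floor y)%:~R : R).
  by apply: nondecreasing_measurable => // x y xy; rewrite ler_int le_floor.
have mmul : measurable_fun setT (fun x : R => beta%:R * x).
  exact: measurable_funM.
exact: (measurable_funB mmul (measurableT_comp mfloor mmul)).
Qed.

(** Under the uniform law the first digit is independent of the image under the
    map: each of the first j branches is an affine bijection onto [0, 1[ of slope
    beta, and contributes 1/beta times the measure of A. *)
Lemma uniform01_renyi (R : realType) (beta j : nat) (A : set R) :
  (0 < beta)%N -> (j <= beta)%N -> measurable A ->
  uniform_prob (@ltr01 R) (`[0, j%:R / beta%:R[ `&` renyi_map beta @^-1` A) =
  ((j%:R / beta%:R)%:E * uniform_prob (@ltr01 R) A)%E.
Proof.
move=> b0 jb mA; have b0R : 0 < beta%:R :> R by rewrite ltr0n.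
have mfA : measurable (renyi_map beta @^-1` A : set R).
  by rewrite -[X in measurable X]setTI; exact: measurable_renyi_map.
elim: j jb => [_|j IH jb].
  by rewrite !mul0r mul0e set_itvco0 set0I measure0.
have jS : j.+1%:R / beta%:R = j%:R / beta%:R + beta%:R^-1 :> R.
  by rewrite -natr1 mulrDl mul1r.
have -> : `[0, j.+1%:R / beta%:R[ `&` renyi_map beta @^-1` A =
  (`[0, j%:R / beta%:R[ `&` renyi_map beta @^-1` A) `|`
  (`[j%:R / beta%:R, j%:R / beta%:R + beta%:R^-1[ `&`
     [set x | A (beta%:R * (x - j%:R / beta%:R))]) :> set R.
  have eqf x : j%:R / beta%:R <= x -> x < j.+1%:R / beta%:R ->
      renyi_map beta x = beta%:R * (x - j%:R / beta%:R) :> R.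
    rewrite ler_pdivrMr // ltr_pdivlMr // => jx xj.
    rewrite (@renyi_map_branch _ _ j); last by rewrite ![beta%:R * _]mulrC jx.
    by field; rewrite gt_eqF.
  rewrite -jS; apply/seteqP; split=> x /=; rewrite !in_itv /=.
    move=> [/andP[x0 xj] Ax]; have [xj'|jx] := ltP x (j%:R / beta%:R).
      by left; split => //; rewrite x0.
    by right; split; rewrite ?xj // -eqf.
  move=> [[/andP[x0 xj] Ax]|[/andP[jx xj]]].
    split => //; rewrite x0 (lt_le_trans xj) // ler_pM2r ?invr_gt0 //.
    by rewrite ler_nat.
  rewrite -eqf // => Ax; split => //; rewrite xj andbT.
  by rewrite (le_trans _ jx) // divr_ge0.
rewrite measureU; last 3 first.
- exact: measurableI.
- apply: measurableI => //; rewrite -[X in measurable X]setTI.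
  have /(_ measurableT A mA) // : measurable_fun setT
      (fun x : R => beta%:R * (x - j%:R / beta%:R)).
  by apply: measurable_funM => //; exact: measurable_funB.
- rewrite -subset0 => x [[]] /=; rewrite !in_itv /= => /andP[_ xj] _ [/andP[jx]].
  by move: (le_lt_trans jx xj); rewrite ltxx.
rewrite [X in (X + _)%E](IH (ltnW jb)) [X in (_ + X)%E]uniform01_affine //.
- by rewrite -ge0_muleDl ?lee_fin ?invr_ge0 ?divr_ge0 // -EFinD jS.
- by rewrite -jS ler_pdivrMr // mul1r ler_nat.
Qed.

Lemma uniform01_preim_renyi (R : realType) (beta : nat) (A : set R) :
  (0 < beta)%N -> measurable A ->
  uniform_prob (@ltr01 R) (renyi_map beta @^-1` A) = uniform_prob (@ltr01 R) A.
Proof.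
move=> b0 mA; have := @uniform01_renyi R beta beta A b0 (leqnn _) mA.
rewrite mulfV ?pnatr_eq0 -?lt0n // mul1e => <-.
have mfA : measurable (renyi_map beta @^-1` A : set R).
  by rewrite -[X in measurable X]setTI; exact: measurable_renyi_map.
apply: (@eq_uniform01 _ 0 0) => //; first exact: measurableI.
by move=> x x01 _ _; split => [|[]//] Ax; split => //=; rewrite in_itv.
Qed.

(** * Orbits that stay below a level *)

Definition orbit_le {R : realType} (beta : nat) (u : R) (n : nat) : set R :=
  [set x | forall i, (i < n)%N -> iter i (renyi_map beta) x <= u].

Lemma orbit_leS (R : realType) (beta : nat) (u : R) (n : nat) :
  orbit_le beta u n.+1 =
  renyi_map beta @^-1` orbit_le beta u n `&` `]-oo, u].
Proof.
apply/seteqP; split=> x /=; rewrite in_itv /= => xP.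
  by split=> [i i_n|]; [rewrite /= -iterSr; exact: xP|exact: (xP 0%N)].
by case: xP => xP xu [|i] // i_n; rewrite iterSr; exact: xP.
Qed.

Lemma measurable_orbit_le (R : realType) (beta : nat) (u : R) (n : nat) :
  measurable (orbit_le beta u n).
Proof.
elim: n => [|n IH].
  by rewrite (_ : orbit_le _ _ _ = setT) //; apply/seteqP; split=> x.
rewrite orbit_leS; apply: measurableI => //.
by rewrite -[X in measurable X]setTI; exact: measurable_renyi_map.
Qed.

(** The index set of the partial maximum contains 0 even for n = 0, while the
    orbit condition is then void. *)
Lemma partial_max_le (R : realType) (T : Type) (X : nat -> T -> R)
    (beta n : nat) (u : R) (w : T) : (0 < n)%N ->
  (forall (i : nat) (w : T), X i.+1 w = renyi_map beta (X i w)) ->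
  (partial_max X n w <= u) <-> orbit_le beta u n (X 0%N w).
Proof.
move=> n0 XS; have XE i : X i w = iter i (renyi_map beta) (X 0%N w).
  by elim: i => // i IH; rewrite XS IH.
rewrite /partial_max big_add1 big_mkord; split=> [/bigmax_leP[x0 xi] [|i] i_n|h].
- by [].
- rewrite -XE; have i_n' : (i < n.-1)%N by rewrite -ltnS prednK.
  exact: (xi (Ordinal i_n')).
- apply/bigmax_leP; split=> [|i _]; first exact: (h 0%N).
  by rewrite XE; apply: h; rewrite -[ltnRHS](prednK n0) ltnS.
Qed.

Lemma renyi_map_top (R : realType) (beta : nat) (x : R) :
  (0 < beta)%N -> 1 - beta%:R^-1 <= x < 1 ->
  renyi_map beta x = 1 - beta%:R * (1 - x).
Proof.
move=> b0 /andP[bx x1]; have b0R : 0 < beta%:R :> R by rewrite ltr0n.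
have bE : beta.-1%:R + 1 = beta%:R :> R by rewrite natr1 prednK.
have bbx : beta%:R * (1 - beta%:R^-1) <= beta%:R * x by rewrite ler_pM2l.
have bx1 : beta%:R * x < beta%:R * 1 by rewrite ltr_pM2l.
move: bbx; rewrite mulrBr mulfV ?gt_eqF // => bbx.
rewrite (@renyi_map_branch _ _ beta.-1); last by rewrite prednK //; lra.
by rewrite -bE; ring.
Qed.

(** While the digits are all maximal the distance to the fixed point 1 of the
    last branch is multiplied by beta at each step. *)
Lemma iter_renyi_map_top (R : realType) (beta k i : nat) (x : R) :
  (0 < beta)%N -> 1 - beta%:R ^- k <= x < 1 -> (i <= k)%N ->
  iter i (renyi_map beta) x = 1 - beta%:R ^+ i * (1 - x).
Proof.
move=> b0 /andP[kx x1] ; have b0R : 0 < beta%:R :> R by rewrite ltr0n.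
elim: i => [_|i IH ik]; first by rewrite /= expr0 mul1r subKr.
rewrite iterS IH 1?ltnW // renyi_map_top //; first by rewrite exprS; ring.
have bi0 : 0 < beta%:R ^+ i :> R by rewrite exprn_gt0.
have x1' : 0 < 1 - x by lra.
rewrite lerD2l lerN2 ltrBlDr ltrDl mulr_gt0 // andbT.
have bSi : beta%:R ^+ i.+1 * (1 - x) <= 1 :> R.
  have : 1 - x <= beta%:R ^- k by lra.
  rewrite -(ler_pM2l (_ : 0 < beta%:R ^+ i.+1)) ?exprn_gt0 // => /le_trans; apply.
  rewrite ler_pdivrMr ?exprn_gt0 // mul1r; apply: ler_weXn2l => //.
  by rewrite ler1n.
by rewrite -[beta%:R^-1]mul1r ler_pdivlMr // mulrAC -exprSr.
Qed.

Lemma uniform01_orbit_le1 (R : realType) (beta : nat) (u : R) : 0 <= u < 1 ->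
  uniform_prob (@ltr01 R) (orbit_le beta u 1) = u%:E.
Proof.
move=> /andP[u0 u1]; rewrite uniform01E; last exact: measurable_orbit_le.
have -> : orbit_le beta u 1 `&` `[0, 1[ = `[0, u]%classic.
  apply/seteqP; split=> x /=; rewrite !in_itv /=.
    by move=> [/(_ 0%N isT) /= -> /andP[-> _]].
  by move=> /andP[-> xu]; split; [case|exact: le_lt_trans u1].
rewrite lebesgue_measure_itv /= lte_fin; case: ltP => [_|u0'].
  by rewrite -EFinB subr0.
by congr EFin; apply/eqP; rewrite eq_le u0.
Qed.

(** Comparison of E (n+1) with f^-1 (E n), which has the measure of E n. The
    difference consists of the x > u with f^(i+1) x <= u for i < n. Putting
    y = f^k x = beta^k (x - u), these conditions reduce to y < 1 - 1/beta and
    f y in E (n-k), so two affine changes of scale give the measure. For n < k the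
    truncated difference n-k makes the second condition void, as it should be. *)
Lemma uniform01_orbit_le_rec (R : realType) (beta k n : nat) :
  (1 < beta)%N -> (0 < k)%N -> (0 < n)%N ->
  let u : R := 1 - beta%:R ^- k in
  uniform_prob (@ltr01 R) (orbit_le beta u n) =
  (uniform_prob (@ltr01 R) (orbit_le beta u n.+1) +
   (beta%:R ^- k * ((beta%:R - 1) / beta%:R))%:E *
     uniform_prob (@ltr01 R) (orbit_le beta u (n - k)))%E.
Proof.
move=> b1 k0 n0 u; have b0 : (0 < beta)%N by exact: ltnW.
have b0R : 0 < beta%:R :> R by rewrite ltr0n.
have b1R : 1 < beta%:R :> R by rewrite ltr1n.
pose f : R -> R := renyi_map beta.
have mE m : measurable (orbit_le beta u m) by exact: measurable_orbit_le.
have mf m : measurable (f @^-1` orbit_le beta u m).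
  by rewrite -[X in measurable X]setTI; exact: measurable_renyi_map.
have mu : measurable (`]-oo, u]%classic : set R) by [].
rewrite -[LHS](uniform01_preim_renyi _ beta) //.
apply: etrans (measureDI (uniform_prob (@ltr01 R)) (mf n) mu) _.
rewrite addeC orbit_leS; congr (_ + _)%E.
pose A : set R :=
  `[0, (beta.-1)%:R / beta%:R[ `&` f @^-1` orbit_le beta u (n - k).
have mA : measurable A by exact: measurableI.
set e : R := beta%:R ^+ k.
have e0 : 0 < e by rewrite exprn_gt0.
have e1 : e^-1 <= 1 by rewrite invf_le1 // exprn_ege1 // ltW.
have uE : u = 1 - e^-1 by [].
have bp : beta%:R - 1 = beta.-1%:R :> R.
  by rewrite -[in LHS](prednK b0) -natr1 addrK.
rewrite EFinM -muleA bp -uniform01_renyi ?leq_pred //.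
rewrite -(uniform01_affine _ e u) // ?subrK ?subr_ge0 //.
(* At x = u and at f x = u the strict and large inequalities disagree. *)
apply: (@eq_uniform01 _ u (1 - e^-1 / beta%:R)).
- exact: measurableD.
- apply: measurableI => //; rewrite -[X in measurable X]setTI.
  have /(_ measurableT A mA) // : measurable_fun setT (fun x : R => e * (x - u)).
  by apply: measurable_funM => //; exact: measurable_funB.
move=> x /andP[x0 x1] xu xv.
have itE i : u < x -> (i <= k)%N -> iter i f x = 1 - beta%:R ^+ i * (1 - x).
  by move=> ux ik; apply: (@iter_renyi_map_top _ _ k) => //; rewrite x1 ltW.
have yE : e * (x - u) = 1 - e * (1 - x).
  by rewrite uE; field; rewrite gt_eqF.
have itk : u < x -> iter k f x = e * (x - u) by move=> ux; rewrite yE itE.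
have iterDk i : u < x -> iter i f (f (e * (x - u))) = iter (i + k) f (f x).
  by move=> ux; rewrite -itk // iterD -iterS iterSr.
(* Both sides say that f x < u, in terms of y and of x respectively. *)
have vE : (e * (x - u) < beta.-1%:R / beta%:R) = (e^-1 < beta%:R * (1 - x)).
  rewrite yE -bp ltr_pdivlMr // mulrBl mul1r ltrD2l ltrN2.
  by rewrite -[e^-1]mul1r ltr_pdivrMr // [_ * e]mulrC mulrA mulrAC.
rewrite /setD /A /= !in_itv /= vE; split.
  (* The step i = 0 bounds y, and the steps i >= k bound the orbit of f y. *)
  move=> [h /negP]; rewrite -ltNge => ux; rewrite (ltW ux) x1.
  rewrite mulr_ge0 ?(ltW e0) ?subr_ge0 ?(ltW ux) //=; split => //; split.
    have := h 0%N n0; rewrite /= -[f x]/(iter 1 f x) itE // expr1 uE.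
    rewrite lerD2l lerN2 le_eqVlt => /orP[/eqP evb|//].
    by case/eqP: xv; rewrite evb; field; rewrite gt_eqF.
  by move=> i ik; rewrite iterDk //; apply: h; lia.
move=> [/andP[ux _] [/andP[_ ev] h]].
have {xu}ux : u < x by rewrite lt_neqAle eq_sym xu.
split; last by apply/negP; rewrite -ltNge.
(* For i < k the bound at i = 0 propagates, since beta^(i+1) (1 - x) grows. *)
move=> i i_n; have [ik|ki] := ltnP i k.
  rewrite -[iter i _ _]iterSr itE // uE lerD2l lerN2.
  apply: le_trans (ltW ev) _.
  rewrite ler_wpM2r ?subr_ge0 ?(ltW x1) //.
  by rewrite -[leLHS]expr1; apply: ler_weXn2l; rewrite ?(ltW b1R).
rewrite -(subnK ki) -iterDk //; apply: h; lia.
Qed.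

(** * Linear recursions with delay *)

(** Replacing the delayed value q (n-k) by q n costs at most p k e per step,
    because q decreases by at most e at each step. The first step, where q drops
    by e rather than by p, accounts for the remaining error e. *)
Lemma delayed_recursion_bounds (R : realType) (q : nat -> R) (p e : R)
    (k : nat) :
  0 <= p <= e -> e <= 1 -> (forall n, 0 <= q n) ->
  q 0%N = 1 -> q 1%N = 1 - e ->
  (forall n, (0 < n)%N -> q n.+1 = q n - p * q (n - k)%N) ->
  forall n, (0 < n)%N ->
    (1 - p) ^+ n - (e + n%:R * p * (k%:R * e)) <= q n <= (1 - p) ^+ n.-1.
Proof.
move=> /andP[p0 pe] e1 q0 q0E q1E qS.
have e0 : 0 <= e by exact: le_trans pe.
have qdecS n : q n.+1 <= q n.
  case: n => [|n]; first by rewrite q0E q1E gerBl.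
  by rewrite qS // gerBl mulr_ge0.
have qdec m n : (m <= n)%N -> q n <= q m.
  move/subnK <-; elim: (n - m)%N => [|i IH] //.
  exact: le_trans (qdecS _) IH.
have q_le1 n : q n <= 1 by rewrite -q0E qdec.
have qstep n : q n <= q n.+1 + e.
  case: n => [|n]; first by rewrite q0E q1E subrK.
  rewrite (qS n.+1) // -subr_ge0.
  have := ler_pM p0 (q0 (n.+1 - k)%N) pe (q_le1 (n.+1 - k)%N); lra.
have qlag n : q (n - k)%N <= q n + k%:R * e.
  elim: k {qS} => [|k IH]; first by rewrite subn0 mul0r addr0.
  rewrite -natr1 mulrDl mul1r addrA; apply: le_trans (_ : q (n - k)%N + e <= _).
    case: (ltnP k n) => kn.
      by rewrite subnS -{2}(prednK (_ : 0 < n - k)%N) ?subn_gt0.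
    have -> : (n - k.+1 = n - k)%N by lia.
    by rewrite lerDl.
  by rewrite lerD2r.
case=> // n _; elim: n => [|n /andP[IHl IHu]].
  have := mulr_ge0 p0 (mulr_ge0 (ler0n R k) e0).
  rewrite q1E expr1 expr0 mul1r => ?; apply/andP; split; lra.
rewrite qS //; apply/andP; split.
  have := ler_wpM2l p0 (qlag n.+1).
  have h : 0 <= p * (e + n.+1%:R * p * (k%:R * e)).
    by rewrite mulr_ge0 // addr_ge0 // !mulr_ge0.
  have p1 : 0 <= 1 - p by lra.
  have := ler_wpM2l p1 IHl.
  move: h; rewrite -[n.+2%:R]natr1 [(1 - p) ^+ n.+2]exprS; lra.
rewrite /= exprSr.
have p1 : 0 <= 1 - p by lra.
have := ler_wpM2r p1 IHu.
have := ler_wpM2l p0 (qdec (n.+1 - k)%N n.+1 (leq_subr _ _)).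
rewrite !mulrBr !mulr1 /= [q n.+1 * p]mulrC; lra.
Qed.

Lemma uniform01_orbit_le_bounds (R : realType) (beta k n : nat) :
  (1 < beta)%N -> (0 < k)%N -> (0 < n)%N ->
  let e : R := beta%:R ^- k in
  let p : R := e * ((beta%:R - 1) / beta%:R) in
  (1 - p) ^+ n - (e + n%:R * p * (k%:R * e)) <=
  fine (uniform_prob (@ltr01 R) (orbit_le beta (1 - e) n)) <= (1 - p) ^+ n.-1.
Proof.
move=> b1 k0 n0 /=; set e : R := beta%:R ^- k; set p : R := e * _.
have b1R : 1 < beta%:R :> R by rewrite ltr1n.
have e0 : 0 < e by rewrite invr_gt0 exprn_gt0 // (lt_trans _ b1R).
have e1 : e <= 1.
  by rewrite invf_le1 ?exprn_gt0 ?exprn_ege1 ?(ltW b1R) // (lt_trans _ b1R).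
have c0 : 0 <= (beta%:R - 1) / beta%:R :> R by rewrite divr_ge0 // subr_ge0 ltW.
have c1 : (beta%:R - 1) / beta%:R <= 1 :> R.
  by rewrite ler_pdivrMr ?(lt_trans _ b1R) // mul1r gerBl.
pose q m := fine (uniform_prob (@ltr01 R) (orbit_le beta (1 - e) m)).
have qE m : (q m)%:E = uniform_prob (@ltr01 R) (orbit_le beta (1 - e) m).
  by rewrite fineK // fin_num_measure //; exact: measurable_orbit_le.
apply: (@delayed_recursion_bounds _ q p e k _ _ _ _ _ _ n n0) => //.
- by rewrite mulr_ge0 ?(ltW e0) //= -[leRHS]mulr1 ler_wpM2l // ltW.
- by move=> m; rewrite fine_ge0.
- apply: EFin_inj; rewrite qE (_ : orbit_le _ _ _ = setT) ?probability_setT //.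
  by apply/seteqP; split=> x.
- by apply: EFin_inj; rewrite qE uniform01_orbit_le1 // subr_ge0 e1 gtrBl.
move=> m m0; have := @uniform01_orbit_le_rec R beta k m b1 k0 m0.
by rewrite /= -!qE -EFinM -EFinD => -[->]; rewrite -/p addrK.
Qed.

(** * Passage to the limit *)

(** The lower bound is 1 + y <= exp y at y = p / (1-p), where 1 + y = 1 / (1-p). *)
Lemma expR_onem_bounds (R : realType) (p : R) (n : nat) : 0 <= p < 1 ->
  expR (- (n%:R * p / (1 - p))) <= (1 - p) ^+ n <= expR (- (n%:R * p)).
Proof.
move=> /andP[p0 p1]; have q0 : 0 < 1 - p by lra.
rewrite -mulrA -mulrN -[- (n%:R * p)]mulrN !expRM_natl; apply/andP; split.
  apply: lerXn2r; rewrite ?nnegrE ?expR_ge0 ?(ltW q0) //.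
  rewrite expRN -[leRHS]invrK lef_pV2 ?posrE ?expR_gt0 ?invr_gt0 //.
  have pE : (1 - p)^-1 = 1 + p / (1 - p) by field; rewrite gt_eqF.
  by rewrite [leLHS]pE expR_ge1Dx.
apply: lerXn2r; rewrite ?nnegrE ?expR_ge0 ?(ltW q0) //.
exact: (le_trans _ (expR_ge1Dx _)).
Qed.

(** An induction shows that k e^k <= 2 (3/4)^k. The ratio 3/4 could be any
    number strictly between 1/2 and 1, with a suitable factor in place of 2. *)
Lemma cvg_natM_exp (R : realType) (e : R) : 0 <= e <= 2^-1 ->
  (k%:R * e ^+ k) @[k --> \oo] --> (0 : R).
Proof.
move=> /andP[e0 e2].
have bnd k : 0 <= k%:R * e ^+ k <= 2 * (3 / 4) ^+ k.
  rewrite mulr_ge0 ?exprn_ge0 //=.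
  elim: k => [|k IH]; first by rewrite mul0r expr0; lra.
  have h : e ^+ k <= (3 / 4) ^+ k by apply: lerXn2r; rewrite ?nnegrE; lra.
  have h' : 0 <= e ^+ k by rewrite exprn_ge0.
  have h2 : 0 <= k%:R * e ^+ k by rewrite mulr_ge0.
  rewrite -natr1 !exprS.
  have -> : (k%:R + 1) * (e * e ^+ k) = e * (k%:R * e ^+ k + e ^+ k) by ring.
  apply: le_trans (_ : 2^-1 * (k%:R * e ^+ k + e ^+ k) <= _).
    by rewrite ler_wpM2r // addr_ge0.
  move: IH h; set X := _ * _ ^+ k; set Y := (3 / 4) ^+ k; lra.
apply: (squeeze_cvgr (f := cst 0) (h := fun k => 2 * (3 / 4) ^+ k)).
- by near=> k; exact: bnd.
- exact: cvg_cst.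
- by apply: cvg_geometric; rewrite ger0_norm; lra.
Unshelve. all: end_near. Qed.

Lemma near_truncn_exp_gt0 (R : realType) (beta : nat) (lambda : R) :
  (1 < beta)%N -> 0 < lambda ->
  \forall k \near \oo, (0 < Num.truncn (beta%:R ^+ k * lambda))%N.
Proof.
move=> b1 l0; have b1R : 1 < beta%:R :> R by rewrite ltr1n.
have b0R : 0 < beta%:R :> R by exact: lt_trans b1R.
have cvge : beta%:R^-1 ^+ k @[k --> \oo] --> (0 : R).
  by apply: cvg_expr; rewrite ger0_norm ?invr_ge0 ?(ltW b0R) // invf_lt1.
near=> k; rewrite truncn_gt0 -ler_pdivrMl ?exprn_gt0 // mulr1 -exprVn.
by near: k; exact: (cvgr_le _ cvge).
Unshelve. all: end_near. Qed.

(** Squeeze: with n p tending to (beta-1)/beta * lambda and p to 0, both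
    exponentials of [expR_onem_bounds] tend to the limit, and the error e + n p k e
    tends to 0. *)
Lemma cvg_uniform01_orbit_le (R : realType) (beta : nat) (lambda : R) :
  (1 < beta)%N -> 0 < lambda ->
  fine (uniform_prob (@ltr01 R) (orbit_le beta (1 - beta%:R ^- k)
     (Num.truncn (beta%:R ^+ k * lambda)))) @[k --> \oo]
    --> expR (- ((beta%:R - 1) / beta%:R * lambda)).
Proof.
move=> b1 l0; set c : R := (beta%:R - 1) / beta%:R.
have b1R : 1 < beta%:R :> R by rewrite ltr1n.
have b0R : 0 < beta%:R :> R by exact: lt_trans b1R.
have c0 : 0 <= c by rewrite divr_ge0 // ?subr_ge0 ltW.
have c1 : c < 1 by rewrite ltr_pdivrMr // mul1r gtrBl.
pose e k : R := beta%:R ^- k.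
pose n k := Num.truncn (beta%:R ^+ k * lambda).
have e0 k : 0 < e k by rewrite invr_gt0 exprn_gt0.
have eX k : e k = beta%:R^-1 ^+ k by rewrite /e exprVn.
have cvge : e k @[k --> \oo] --> (0 : R).
  rewrite (_ : e = fun k => beta%:R^-1 ^+ k); last exact/funext.
  by apply: cvg_expr; rewrite ger0_norm ?invr_ge0 ?(ltW b0R) // invf_lt1.
have cvgke : (k%:R * e k) @[k --> \oo] --> (0 : R).
  rewrite (_ : (fun k => k%:R * e k) =
      fun k => k%:R * beta%:R^-1 ^+ k); last first.
    by apply/funext => k; rewrite eX.
  apply: cvg_natM_exp; rewrite invr_ge0 (ltW b0R) /= lef_pV2 ?posrE //.
  by rewrite ler_nat.
have nb k : lambda - e k <= (n k)%:R * e k <= lambda.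
  have lk : 0 <= beta%:R ^+ k * lambda.
    by rewrite mulr_ge0 ?exprn_ge0 ?(ltW l0) ?(ltW b0R).
  have /andP[nl nu] := truncn_itv lk.
  have lE : lambda = (beta%:R ^+ k * lambda) * e k.
    by rewrite mulrAC mulfV ?mul1r // gt_eqF // exprn_gt0.
  apply/andP; split; last by rewrite [leRHS]lE ler_wpM2r // ltW.
  rewrite lerBlDr [leLHS]lE -[X in _ <= _ + X]mul1r -mulrDl natr1.
  by rewrite ler_wpM2r // ltW.
have cvgne : ((n k)%:R * e k) @[k --> \oo] --> lambda.
  apply: (squeeze_cvgr (f := fun k => lambda - e k) (h := cst lambda)).
  - by near=> k; exact: nb.
  - by rewrite -[X in _ --> X]subr0; apply: cvgB => //; exact: cvg_cst.
  - exact: cvg_cst.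
pose p k := e k * c.
have cvgp : p k @[k --> \oo] --> (0 : R).
  by rewrite -(mul0r c); apply: cvgM => //; exact: cvg_cst.
have cvgnp : ((n k)%:R * p k) @[k --> \oo] --> c * lambda.
  rewrite mulrC; under eq_fun do rewrite mulrA.
  by apply: cvgM => //; exact: cvg_cst.
have exp_cvg (a : nat -> R) : a k @[k --> \oo] --> c * lambda ->
    expR (- a k) @[k --> \oo] --> expR (- (c * lambda)).
  move=> h; apply: (cvg_comp (fun k => - a k) expR); last exact: continuous_expR.
  exact: cvgN.
apply: (squeeze_cvgr
  (f := fun k => expR (- ((n k)%:R * p k / (1 - p k)))
                 - (e k + (n k)%:R * p k * (k%:R * e k)))
  (h := fun k => expR (- ((n k)%:R * p k - p k)))).
- near=> k.
  have n0 : (0 < n k)%N by near: k; exact: near_truncn_exp_gt0.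
  have k0 : (0 < k)%N by near: k; exact: nbhs_infty_gt.
  have p01 : 0 <= p k < 1.
    rewrite mulr_ge0 ?(ltW (e0 k)) //=.
    by near: k; exact: (cvgr_lt _ cvgp).
  have /andP[lo hi] := @uniform01_orbit_le_bounds R beta k (n k) b1 k0 n0.
  have /andP[elo _] := @expR_onem_bounds R (p k) (n k) p01.
  have /andP[_ ehi] := @expR_onem_bounds R (p k) (n k).-1 p01.
  apply/andP; split.
    by apply: le_trans lo; rewrite lerD2r.
  apply: le_trans hi _; apply: le_trans ehi _.
  rewrite ler_expR lerN2 -[X in _ - X]mul1r -mulrBl.
  by rewrite -[in X in X - 1](prednK n0) -natr1 addrK.
- rewrite -[X in _ --> X]subr0; apply: cvgB.
    apply: exp_cvg; rewrite -[X in _ --> X]mulr1; apply: cvgM => //.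
    rewrite -[X in _ --> X]invr1; apply: cvgV; first exact: oner_neq0.
    by rewrite -[X in _ --> X]subr0; apply: cvgB => //; exact: cvg_cst.
  rewrite -[X in _ --> X]addr0; apply: cvgD => //.
  by rewrite -(mulr0 (c * lambda)); apply: cvgM.
- apply: exp_cvg; rewrite -[X in _ --> X]subr0; exact: cvgB.
Unshelve. all: end_near. Qed.

Theorem theorem1p2 (R : realType) (d : measure_display) (T : measurableType d)
    (P : probability T R) (beta : nat) (lambda : R)
    (X : nat -> {RV P >-> R}) :
  (1 < beta)%N -> 0 < lambda ->
  uniform01 (X 0%N) ->
  (forall (i : nat) (w : T), X i.+1 w = renyi_map beta (X i w)) ->
  P [set w | partial_max X (Num.truncn (beta%:R ^+ k * lambda)) w
             <= 1 - beta%:R ^- k] @[k --> \oo]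
    --> (expR (- ((beta%:R - 1) / beta%:R * lambda)))%:E.
Proof.
move=> b1 l0 X0unif XS.
pose n k := Num.truncn (beta%:R ^+ k * lambda).
have PE : \forall k \near \oo,
    P [set w | partial_max X (n k) w <= 1 - beta%:R ^- k] =
    uniform_prob (@ltr01 R) (orbit_le beta (1 - beta%:R ^- k) (n k)).
  near=> k; have n0 : (0 < n k)%N.
    by near: k; exact: near_truncn_exp_gt0.
  rewrite -X0unif; last exact: measurable_orbit_le.
  congr (P _); apply/seteqP.
  by split=> w /(@partial_max_le R T X beta (n k) _ w n0 XS).
apply: cvg_EFin.
  near=> k; rewrite (near PE k) //.
  by rewrite fin_num_measure //; exact: measurable_orbit_le.
apply: cvg_trans (@cvg_uniform01_orbit_le R beta lambda b1 l0).
apply: near_eq_cvg; near=> k; congr fine; apply/esym; near: k; exact: PE.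
Unshelve. all: end_near. Qed.
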